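(* The generalized topological space $\langle\mathbb{R},\mathcal{T}^+\rangle$ is regular; that is, for every $\mathcal{T}^+$-closed set $F\subset\mathbb{R}$ and every $x\in\mathbb{R}\setminus F$ there exist disjoint sets $V,W\in\mathcal{T}^+$ with $x\in V$ and $F\subset W$.
   Context: $\mathcal{L}$ is the family of Lebesgue measurable subsets of $\mathbb{R}$, $\lambda$ is Lebesgue measure. For $A\in\mathcal{L}$ and $x\in\mathbb{R}$ put $\bar D(A,x)=\limsup_{h\to0^+}\frac{\lambda(A\cap[x-h,x+h])}{2h}$, $\Phi^+(A)=\{x\in\mathbb{R}:\bar D(A,x)>0\}$, and $\mathcal{T}^+=\{A\in\mathcal{L}:A\subset\Phi^+(A)\}$. The family $\mathcal{T}^+$ contains $\emptyset$ and $\mathbb{R}$ and is closed under arbitrary unions (a strong generalized topology). A set is $\mathcal{T}^+$-closed if its complement in $\mathbb{R}$ belongs to $\mathcal{T}^+$. *)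

(* Defs.v *)
From mathcomp Require Import all_boot all_order all_algebra.
From mathcomp Require Import all_classical all_reals all_analysis.

Set Implicit Arguments.
Unset Strict Implicit.
Unset Printing Implicit Defensive.

Import Order.TTheory GRing.Theory Num.Theory.
Import numFieldNormedType.Exports.

Local Open Scope classical_set_scope.
Local Open Scope ring_scope.

(* [measurable] on the real line itself denotes the Borel sets.  The Lebesgue
   measurable sets are the Caratheodory sets of the outer measure generated by
   interval length, i.e. the domain of [completed_lebesgue_measure]; by
   [completed_caratheodory_measurable] they are also the sets B `|` N with B
   Borel and N negligible. *)
Definition Lebesgue_measurable (R : realType) : set (set R) :=
  ((@wlength R idfun)^*%mu).-cara.-measurable.

(* The limsup is taken along the filter 0^'+ of h tending to 0 with 0 < h. *)
Definition upper_density (R : realType) (A : set R) (x : R) : \bar R :=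
  limf_esup
    (fun h : R =>
       (completed_lebesgue_measure (A `&` `[(x - h)%R, (x + h)%R])
          / (2 * h)%:E)%E)
    0^'+.

Definition PhiP (R : realType) (A : set R) : set R :=
  [set x | (0 < upper_density A x)%E].

Definition TP (R : realType) : set (set R) :=
  [set A | Lebesgue_measurable A /\ A `<=` PhiP A].

Definition TP_closed (R : realType) (F : set R) : Prop := TP (~` F).

(* Main.v *)
Require Import Defs.
From mathcomp Require Import all_boot all_order all_algebra.
From mathcomp Require Import all_classical all_reals all_analysis.
From mathcomp Require Import measurable_realfun lra.

(** If [A = ~` F] and [x] is in [A], there is a closed [K] with
    [x \in K `<=` A] such that [A `\` K] has measure at most [e * h] in every
    interval of radius [h] around [x]; for small [e], [K] still has positive
    upper density at [x].  Take [W := ~` K], which is open, and let [V] be the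
    set of points of [K] where [K] has positive upper density; by the Lebesgue
    density theorem [V] differs from [K] by a null set. *)

Import Order.TTheory GRing.Theory Num.Theory.
Import numFieldNormedType.Exports.

Local Open Scope classical_set_scope.

Section UpperDensity.
Local Open Scope ring_scope.
Context {R : realType}.
Implicit Types (A K N : set R) (x y h e : R).

Local Notation mu := ((@wlength R idfun)^*%mu).
Local Notation B x h := `[(x - h)%R, (x + h)%R]%classic.

(** Trades the limsup for a statement with quantifiers: it is positive exactly when the ratio stays
    above a fixed constant at arbitrarily small [h]. The 2 of the denominator [2 * h] is absorbed
    into [c]. *)
Lemma upper_density_gt0P A x :
  (0 < upper_density A x)%E <->
  exists2 c : R, 0 < c & forall d : R, 0 < d ->
    exists2 h, 0 < h < d & ((c * h)%:E <= mu (A `&` B x h))%E.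
Proof.
rewrite /upper_density; set f := (X in limf_esup X _).
rewrite limf_esupE; split.
- move=> D0.
  have [c c0 cD] : exists2 c : R, 0 < c &
      (c%:E < ereal_inf [set ereal_sup (f @` V) | V in 0^'+])%E.
    (* [D] is not yet known to be finite, so the value [+oo] gets its own [c]. *)
    move: D0; set D := ereal_inf _; case: D => [r| |] //.
      rewrite lte_fin => r0; exists (r / 2); first by rewrite divr_gt0.
      by rewrite lte_fin; lra.
    by move=> _; exists 1 => //; rewrite ltry.
  exists (2 * c); first by rewrite mulr_gt0.
  move=> d d0.
  have : (c%:E < ereal_sup (f @` [set h : R | (0 < h < d)%R]))%E.
    apply: (lt_le_trans cD); apply: ereal_inf_lbound => /=.
    exists [set h : R | 0 < h < d] => //.
    near=> h => /=; apply/andP; split; near: h.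
      exact: nbhs_right_gt.
    exact: nbhs_right_lt.
  move=> /ereal_sup_gt[_ /= [h /andP[h0 hd] <-] ch].
  exists h; first by rewrite h0.
  move: ch; rewrite /f inver mulf_eq0 pnatr_eq0 /= gt_eqF//.
  rewrite lte_pdivlMr ?mulr_gt0// -EFinM => /ltW.
  by rewrite mulrCA mulrA.
- move=> [c c0 cA]; apply: (@lt_le_trans _ _ (c / 2)%:E).
    by rewrite lte_fin divr_gt0.
  apply: le_ereal_inf_tmp => _ /= [V V0 <-].
  have [d /= d0 dV] := V0.
  have [h /andP[h0 hd] ch] := cA _ d0.
  apply: le_ereal_sup_tmp; exists (f h).
    exists h => //; apply: dV => //=.
    by rewrite sub0r normrN gtr0_norm.
  rewrite /f inver mulf_eq0 pnatr_eq0 /= gt_eqF//.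
  rewrite lee_pdivlMr ?mulr_gt0// -EFinM.
  by rewrite mulrA divfK.
Unshelve. all: by end_near. Qed.

Lemma borel_Lebesgue_measurable A :
  measurable (A : set (measurableTypeR R)) -> Lebesgue_measurable A.
Proof. exact: sub_caratheodory. Qed.

(** Small intervals around a point of [A] lie inside [A], so their measure is [2 * h] and [c = 2]
    works. *)
Lemma open_TP A : open A -> TP A.
Proof.
move=> oA; split.
  by apply: borel_Lebesgue_measurable; exact: open_measurable.
move=> x Ax; apply/upper_density_gt0P; exists 2 => // d d0.
have /nbhs_ballP[r /= r0 rA] : nbhs x A by exact: open_nbhs_nbhs.
pose m := Num.min r d; have m0 : 0 < m by rewrite lt_min r0.
have mr : m <= r by rewrite ge_min lexx.
have md : m <= d by rewrite ge_min lexx orbT.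
exists (m / 2); first lra.
rewrite setIidr; last first.
  move=> y /=; rewrite in_itv/= => /andP[y1 y2].
  apply: rA; rewrite /ball/= ltr_norml; lra.
rewrite -[X in (_ <= X)%E]/(lebesgue_measure (B x (m / 2))).
rewrite lebesgue_measure_itv/= lte_fin ifT; last lra.
by rewrite -EFinD lee_fin; lra.
Qed.

(* The complement of [A] is cut into annuli around [x]; the [n]-th one is covered
   by an open [G n], with an excess [d n], truncated to [|y - x| > 1/(n+2)].
   This piece meets the interval of radius [h] only if [h > 1/(n+2)], and then
   its excess [d n] is at most [e * h / 2^(n+1)]. *)
Lemma closed_core A x e : Lebesgue_measurable A -> A x -> 0 < e ->
  exists K, [/\ closed K, K `<=` A, K x &
    forall h, 0 < h -> (mu ((A `\` K) `&` B x h) <= (e * h)%:E)%E].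
Proof.
move=> mA Ax e0.
pose S n : set R := [set y | n.+1%:R^-1 <= `|y - x| <= n.+1%:R].
pose F n : set R := ~` A `&` S n.
pose T n : set R := [set y | n.+2%:R^-1 < `|y - x|].
have cdist : continuous (fun y : R => `|y - x|).
  by move=> y; apply: cvg_norm; apply: cvgB; [exact: cvg_id|exact: cvg_cst].
have oT n : open (T n).
  by apply: (@open_comp _ _ (fun y => `|y - x|) [set z | _ < z]) => [y _|];
    [exact: cdist|exact: open_gt].
have mS n : Lebesgue_measurable (S n).
  apply: borel_Lebesgue_measurable; apply: closed_measurable.
  rewrite (_ : S n = (fun y => `|y - x|) @^-1` [set z | n.+1%:R^-1 <= z] `&`
    (fun y => `|y - x|) @^-1` [set z | z <= n.+1%:R]); last first.
    by apply/seteqP; split => y /=; [move/andP|move=> ?; exact/andP].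
  by apply: closedI; apply: (@preimage_closed _ _ (fun y : R => `|y - x|)) => [y _|];
    [exact: cdist|exact: closed_ge|exact: cdist|exact: closed_le].
have mF n : Lebesgue_measurable (F n).
  apply: caratheodory_measurable_setI; last exact: mS.
  exact: caratheodory_measurable_setC.
(* The outer radius of [S n] serves this bound, which lets [mu (F n)] be cancelled when the excess
   of [G n] is estimated. *)
have finF n : (mu (F n) < +oo)%E.
  apply: (@le_lt_trans _ _ (lebesgue_measure (B x n.+1%:R))).
    apply: le_outer_measure => y [_ /= /andP[_]].
    by rewrite ler_norml in_itv/= => /andP[? ?]; lra.
  by rewrite lebesgue_measure_itv/=; case: ifP => _; rewrite -?EFinD ltry.
pose d n : R := e * n.+2%:R^-1 / (2 ^ n.+1)%:R.
have p2 n : 0 < (2 ^ n.+1)%:R :> R by rewrite ltr0n expn_gt0.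
have d0 n : 0 < d n by rewrite /d divr_gt0// mulr_gt0// invr_gt0.
have GE : forall n, exists G : set R,
    [/\ open G, F n `<=` G & (mu (G `\` F n) <= (d n)%:E)%E].
  move=> n; have [G [oG FG le]] := outer_measure_open_le (F n) (d0 n).
  exists G; split => //.
  have finFn : mu (F n) \is a fin_num by rewrite ge0_fin_numE ?outer_measure_ge0 ?finF.
  (* The Caratheodory condition for [F n], tested on [G], splits [mu G]. *)
  move: le; rewrite -[X in (X <= _)%E]/(mu G) (mF n G) setIidr//.
  by rewrite -setDE leeD2lE.
have [G GP] := choice GE.
pose U := \bigcup_n (G n `&` T n).
have oU : open U by apply: bigcup_open => n _; apply: openI => //; case: (GP n).
exists (~` U); split.
- exact: open_closedC.
- move=> y nU; apply: contrapT => nA; apply: nU.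
  have xy : 0 < `|y - x|.
    by rewrite normr_gt0 subr_eq0; apply/eqP => yx; apply: nA; rewrite yx.
  have [n [n1 n2]] : exists n : nat,
      n.+1%:R^-1 <= `|y - x| /\ `|y - x| <= n.+1%:R.
    have := near_infty_natSinv_lt (PosNum xy) => -[N1 _ /= HN1].
    have [N2 HN2] : exists N2 : nat, `|y - x| <= N2%:R.
      by exists (Num.truncn `|y - x|).+1; apply/ltW; exact: truncnS_gt.
    exists (maxn N1 N2); split.
      by apply/ltW/HN1 => /=; exact: leq_maxl.
    by apply: (le_trans HN2); rewrite ler_nat leqW// leq_maxr.
  (* Truncation loses no point of [F n], as 1/(n+2) < 1/(n+1). *)
  exists n => //; split; last first.
    by rewrite /T/=; apply: lt_le_trans n1; rewrite ltf_pV2 ?posrE// ltr_nat.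
  by case: (GP n) => _ + _; apply; split => //=; apply/andP.
- by move=> [n _ []] _; rewrite /T/= subrr normr0 ltNge invr_ge0 ler0n.
- move=> h h0.
  have -> : (A `\` ~` U) `&` B x h =
      \bigcup_n (A `&` (G n `&` T n) `&` B x h).
    by rewrite setDE setCK setI_bigcupr setI_bigcupl.
  apply: le_trans (outer_measure_sigma_subadditive mu _) _.
  have eh0 : 0 <= e * h by rewrite mulr_ge0// ltW.
  apply: le_trans (epsilon_trick0 xpredT eh0).
  apply: lee_nneseries => // n _.
  have [hn|nh] := leP h n.+2%:R^-1.
    rewrite (_ : _ `&` _ `&` _ = set0) ?outer_measure0 ?lee_fin ?divr_ge0//.
    apply/seteqP; split => // y [[_ [_]]]; rewrite /T/= in_itv/= => Ty yB.
    have : `|y - x| <= h by rewrite ler_norml; lra.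
    by rewrite leNgt (le_lt_trans hn).
  have [_ _ Gd] := GP n.
  apply: (@le_trans _ _ (d n)%:E); last first.
    by rewrite lee_fin /d ler_wpM2r ?invr_ge0// ler_wpM2l// ltW.
  (* A point of [A] is never in [F n], so this piece lies in the excess of [G n]. *)
  apply: le_trans Gd; apply: le_outer_measure => y [[Ay [Gy _]] _].
  by split => // -[].
Qed.

(** Almost every point of [K] is a density point, hence in [PhiP K]; the exceptions lie in a Borel
    null set, so they are Lebesgue measurable by completeness. *)
Lemma closed_density_null K : closed K ->
  Lebesgue_measurable (K `\` PhiP K) /\ mu (K `\` PhiP K) = 0%E.
Proof.
move=> cK.
have mK : measurable (K : set (measurableTypeR R)) by exact: closed_measurable.
have [Z [mZ Z0 NZ]] := lebesgue_density mK.
have KZ : K `\` PhiP K `<=` Z.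
  move=> x [Kx nP]; apply: NZ => /= cvg; apply: nP.
  (* A ratio above 1/2 on a ball of measure [2 * r] gives measure above [r], whence [c = 1]. *)
  apply/upper_density_gt0P; exists 1 => // d d0.
  move: cvg; rewrite indicE mem_set//= => cvg.
  have : \forall r \near 0^'+, ((2^-1)%:E <
      lebesgue_measure (K `&` ball x r) * (lebesgue_measure (ball x r))^-1)%E.
    apply: (cvg [set z | (2^-1)%:E < z]%E); apply: open_nbhs_nbhs; split.
      exact: open_ereal_gt_ereal.
    by rewrite /= lte_fin; lra.
  move=> lt2.
  have : \forall r \near 0^'+, 0 < r < d /\ ((2^-1)%:E <
      lebesgue_measure (K `&` ball x r) * (lebesgue_measure (ball x r))^-1)%E.
    near=> r; split; last by near: r.
    by apply/andP; split; near: r; [exact: nbhs_right_gt|exact: nbhs_right_lt].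
  move=> /filter_ex[r [/andP[r0 rd]]].
  rewrite lebesgue_measure_ball; last exact: ltW.
  rewrite inver mulrn_eq0/= gt_eqF//.
  rewrite lte_pdivlMr; last by rewrite mulrn_wgt0.
  rewrite -EFinM -(mulr_natl r) mulKf ?pnatr_eq0// => lt.
  exists r; first by rewrite r0.
  rewrite mul1r; apply: (le_trans (ltW lt)).
  apply: le_outer_measure; apply: setIS => y.
  by rewrite /ball/= in_itv/= ltr_norml => ?; lra.
split => //.
  apply: negligible_sub_caratheodory; exists Z; split => //.
  exact: borel_Lebesgue_measurable.
apply/eqP; rewrite eq_le outer_measure_ge0 andbT -Z0.
exact: le_outer_measure.
Unshelve. all: by end_near. Qed.

Lemma PhiP_setD_null K N : mu N = 0%E -> PhiP K `<=` PhiP (K `\` N).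
Proof.
move=> N0 x /upper_density_gt0P[c c0 cK]; apply/upper_density_gt0P.
exists c => // d d0; have [h hd ch] := cK _ d0; exists h => //.
apply: (le_trans ch); rewrite -[leRHS]add0e -N0.
apply: le_trans (outer_measureU2 mu _ _).
by apply: le_outer_measure => y [Ky By]; have [Ny|nN] := pselect (N y);
  [left|right].
Qed.

(** Passing from [K] to this set removes only a null set, so positive upper density survives at each
    remaining point. *)
Lemma closed_TP_core K : closed K -> TP (K `&` PhiP K).
Proof.
move=> cK; have [mN N0] := closed_density_null _ cK.
have KN : K `&` PhiP K = K `\` (K `\` PhiP K) by rewrite setDD.
split.
  rewrite KN; apply: caratheodory_measurable_setD => //.
  by apply: borel_Lebesgue_measurable; exact: closed_measurable.
by rewrite {2}KN => x [_ Px]; exact: PhiP_setD_null.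
Qed.

Lemma closed_core_PhiP A x : TP A -> A x ->
  exists K, [/\ closed K, K `<=` A, K x & PhiP K x].
Proof.
move=> [mA AP] Ax; have /upper_density_gt0P[c c0 cA] := AP _ Ax.
(* With [e = c / 2], the part of [A] lost outside [K] takes at most half of the lower bound
   [c * h]. *)
have c20 : 0 < c / 2 by rewrite divr_gt0.
have [K [cK KA Kx Kh]] := closed_core _ _ _ mA Ax c20.
exists K; split => //; apply/upper_density_gt0P; exists (c / 2) => // d d0.
have [h /andP[h0 hd] ch] := cA _ d0; exists h; first by rewrite h0.
have : ((c * h)%:E <= (c / 2 * h)%:E + mu (K `&` B x h))%E.
  apply: (le_trans ch); apply: le_trans (leeD2r _ (Kh _ h0)).
  apply: le_trans (outer_measureU2 mu _ _).
  by apply: le_outer_measure => y [Ay By]; have [Ky|nK] := pselect (K y);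
    [right|left].
rewrite -leeBlDl// -EFinB; apply: le_trans.
by rewrite lee_fin; lra.
Qed.

End UpperDensity.

Theorem theorem17 (R : realType) (F : set R) (x : R) :
  TP_closed F -> (~` F) x ->
  exists V W : set R,
    [/\ TP V, TP W, V `&` W = set0, V x & F `<=` W].
Proof.
move=> cF Fx; have [K [cK KF Kx Px]] := closed_core_PhiP _ _ cF Fx.
(* The point [x] stays in [V] because [K] was chosen with [PhiP K x]. *)
exists (K `&` PhiP K), (~` K); split.
- exact: closed_TP_core.
- by apply: open_TP; exact: closed_openC.
- by rewrite setIAC setICr set0I.
- by [].
- by move=> y Fy /KF.
Qed.
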